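(* Let $N\ge 1$ and let $\tilde{\mathcal{S}}_N\subset U(N)$ be the compact group of all matrices $\bigl(e^{\mathrm{i}\phi_j}\delta^j_{\sigma(i)}\bigr)_{1\le i,j\le N}$ with $\sigma$ a permutation of $\{1,\dots,N\}$ and $\phi_1,\dots,\phi_N\in\mathbb{R}$. Let $S_N$ be a random element of $\tilde{\mathcal{S}}_N$ distributed according to the Haar probability measure $\mu_{\tilde{\mathcal{S}}_N}$. Then $$\det(\mathrm{Id}_N-S_N)\overset{\text{law}}{=}\prod_{k=1}^N\bigl(1-e^{\mathrm{i}\theta_k}X_k\bigr),$$ where $\theta_1,\dots,\theta_N,X_1,\dots,X_N$ are independent random variables, each $\theta_k$ is uniformly distributed on $(0,2\pi)$, and each $X_k$ is a Bernoulli variable with $\mathbb{P}(X_k=1)=1/k$ and $\mathbb{P}(X_k=0)=1-1/k$.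
   Context: $\delta^j_{i}$ is Kronecker's symbol, equal to $1$ if $i=j$ and $0$ otherwise. Under the Haar probability measure on $\tilde{\mathcal{S}}_N$, the permutation $\sigma$ is uniform on the symmetric group $\mathcal{S}_N$ and is independent of the phases $\phi_1,\dots,\phi_N$, which are independent and uniform on $(0,2\pi)$ (modulo $2\pi$). *)

(* Defs.v *)
From HB Require Import structures.
From mathcomp Require Import all_boot all_order all_algebra all_fingroup.
From mathcomp Require Import all_classical all_reals all_analysis.
From mathcomp Require Import complex.

Set Implicit Arguments.
Unset Strict Implicit.
Unset Printing Implicit Defensive.

Import Order.TTheory GRing.Theory Num.Theory.
Import numFieldNormedType.Exports.

Local Open Scope classical_set_scope.
Local Open Scope ring_scope.

(* Packing [R[i]] as an abstract field is what gives it the usual topology of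
   the complex plane: MathComp-Analysis attaches the norm topology to variables
   of type [numClosedFieldType], not to the concrete carrier. *)
Definition Cplx (R : realType) : numClosedFieldType := R[i].

Definition of_real (R : realType) (x : R) : Cplx R := (x%:C)%C.

(* e^{i t} *)
Definition expi (R : realType) (t : R) : Cplx R := (cos t +i* sin t)%C.

(* A topological space with its Borel sigma-algebra; matrices carry the
   entrywise topology. *)
Notation borelType T := (g_sigma_algebraType (@open T)).

Definition phase_perm_mx (R : realType) (N : nat) (s : 'S_N) (phi : 'I_N -> R) :
  'M[Cplx R]_N := \matrix_(i, j) (expi (phi j) * (j == s i)%:R).

Definition phase_perm_group (R : realType) (N : nat) : set 'M[Cplx R]_N :=
  [set M | exists (s : 'S_N) (phi : 'I_N -> R), M = phase_perm_mx s phi].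
Arguments phase_perm_group : clear implicits.

(* The Haar probability measure of a compact matrix group [G], seen as a Borel
   measure on all matrices: it is carried by [G] and invariant under left
   translations by elements of [G]. *)
Definition is_haar_probability (R : realType) (N : nat) (G : set 'M[Cplx R]_N)
    (mu : probability (borelType 'M[Cplx R]_N) R) : Prop :=
  mu G = 1%E /\
  forall (g : 'M[Cplx R]_N) (A : set (borelType 'M[Cplx R]_N)),
    G g -> measurable A -> mu ((fun s => g *m s) @^-1` A) = mu A.

Definition mutually_independent (d d' : measure_display)
    (T : measurableType d) (T' : measurableType d') (R : realType)
    (P : probability T R) (I : finType) (X : I -> {RV P >-> T'}) : Prop :=
  forall (J : {set I}) (A : I -> set T'), (forall i, measurable (A i)) ->
    P (\bigcap_(i in [set` J]) (X i @^-1` A i)) =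
    (\prod_(i in J) P (X i @^-1` A i))%E.

Lemma twopi_gt0 (R : realType) : 0 < 2 * pi :> R.
Proof. by rewrite mulr_gt0// pi_gt0. Qed.

Definition uniform_phase (d : measure_display) (T : measurableType d)
    (R : realType) (P : probability T R) (X : {RV P >-> R}) : Prop :=
  forall A : set R, measurable A ->
    distribution P X A = uniform_prob (twopi_gt0 R) A.

Definition bernoulli_rv (d : measure_display) (T : measurableType d)
    (R : realType) (P : probability T R) (X : {RV P >-> R}) (p : R) : Prop :=
  P (X @^-1` [set 1]) = p%:E /\ P (X @^-1` [set 0]) = (1 - p)%:E.

Definition eq_in_law (d1 d2 d' : measure_display) (T1 : measurableType d1)
    (T2 : measurableType d2) (T' : measurableType d') (R : realType)
    (P1 : probability T1 R) (P2 : probability T2 R)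
    (X1 : T1 -> T') (X2 : T2 -> T') : Prop :=
  [/\ measurable_fun setT X1, measurable_fun setT X2 &
      forall A : set T', measurable A -> P1 (X1 @^-1` A) = P2 (X2 @^-1` A)].

(* Main.v *)
Require Import Defs.
From HB Require Import structures.
From mathcomp Require Import all_boot all_order all_algebra all_fingroup.
From mathcomp Require Import all_classical all_reals all_analysis.
From mathcomp Require Import complex.
From mathcomp Require Import measurable_realfun ring lra.

Set Implicit Arguments.
Unset Strict Implicit.
Unset Printing Implicit Defensive.

Import Order.TTheory GRing.Theory Num.Theory.
Import numFieldNormedType.Exports.

Local Open Scope classical_set_scope.
Local Open Scope ring_scope.

(* If [G] is a random element of the group with a uniform permutation and
   independent uniform phases, left invariance and Tonelli give
   P(det(1 - S) in A) = E[P(det(1 - G M) in A)] evaluated at M = S, so it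
   suffices to treat a fixed [M] in the group. There det(1 - G M) = det(1 - M G),
   and [M G] is again a permutation matrix weighted by independent uniform phases
   up to constant rotations, which do not change the law. The law of its
   determinant is found by induction on the size, removing the last index: with
   probability 1/n it is fixed and contributes a factor 1 - e^{i theta};
   otherwise its phase is absorbed by the next index of its cycle, and uniformity
   of that index's phase makes the absorbed one disappear in law. The Bernoulli
   variables X_n encode this dichotomy. *)

(** * Measurability of complex-valued functions *)

(** Working with the two real coordinates lets closure under ring operations follow from the real
    case; [cmeasurable_borel] then converts this notion into Borel measurability. *)
Definition cmeasurable (R : realType) d (T : measurableType d) (h : T -> Cplx R) :=
  measurable_fun setT (fun x => complex.Re (h x) : R) /\
  measurable_fun setT (fun x => complex.Im (h x) : R).

Section ComplexMeasurability.
Context (R : realType) d (T : measurableType d).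
Implicit Types h : T -> Cplx R.

Lemma cmeasurable_cst (c : Cplx R) : cmeasurable (fun _ : T => c).
Proof. by split. Qed.

Lemma cmeasurableD h1 h2 : cmeasurable h1 -> cmeasurable h2 ->
  cmeasurable (fun x => h1 x + h2 x).
Proof.
move=> [r1 i1] [r2 i2]; split.
- rewrite (_ : (fun _ => _) = (fun x => complex.Re (h1 x) + complex.Re (h2 x))).
    exact: measurable_funD.
  by apply/funext => x; case: (h1 x) (h2 x) => ? ? [].
- rewrite (_ : (fun _ => _) = (fun x => complex.Im (h1 x) + complex.Im (h2 x))).
    exact: measurable_funD.
  by apply/funext => x; case: (h1 x) (h2 x) => ? ? [].
Qed.

Lemma cmeasurableN h : cmeasurable h -> cmeasurable (fun x => - h x).
Proof.
move=> [r i]; split.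
- rewrite (_ : (fun _ => _) = (fun x => - complex.Re (h x))).
    exact: measurable_funN.
  by apply/funext => x; case: (h x).
- rewrite (_ : (fun _ => _) = (fun x => - complex.Im (h x))).
    exact: measurable_funN.
  by apply/funext => x; case: (h x).
Qed.

Lemma cmeasurableM h1 h2 : cmeasurable h1 -> cmeasurable h2 ->
  cmeasurable (fun x => h1 x * h2 x).
Proof.
move=> [r1 i1] [r2 i2]; split.
- rewrite (_ : (fun _ => _) = (fun x => complex.Re (h1 x) * complex.Re (h2 x)
      - complex.Im (h1 x) * complex.Im (h2 x))).
    by apply: measurable_funB; exact: measurable_funM.
  by apply/funext => x; case: (h1 x) (h2 x) => ? ? [].
- rewrite (_ : (fun _ => _) = (fun x => complex.Re (h1 x) * complex.Im (h2 x)
      + complex.Im (h1 x) * complex.Re (h2 x))).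
    by apply: measurable_funD; exact: measurable_funM.
  by apply/funext => x; case: (h1 x) (h2 x) => ? ? [].
Qed.

Lemma cmeasurable_sum (I : Type) (r : seq I) (P : pred I) (h : I -> T -> Cplx R) :
  (forall i, cmeasurable (h i)) -> cmeasurable (fun x => \sum_(i <- r | P i) h i x).
Proof.
move=> mh; elim: r => [|i r IH].
  by under [X in cmeasurable X]eq_fun do rewrite big_nil; exact: cmeasurable_cst.
under [X in cmeasurable X]eq_fun do rewrite big_cons.
by case: (P i) => //; exact: cmeasurableD.
Qed.

Lemma cmeasurable_prod (I : Type) (r : seq I) (P : pred I) (h : I -> T -> Cplx R) :
  (forall i, cmeasurable (h i)) -> cmeasurable (fun x => \prod_(i <- r | P i) h i x).
Proof.
move=> mh; elim: r => [|i r IH].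
  by under [X in cmeasurable X]eq_fun do rewrite big_nil; exact: cmeasurable_cst.
under [X in cmeasurable X]eq_fun do rewrite big_cons.
by case: (P i) => //; exact: cmeasurableM.
Qed.

Lemma cmeasurable_det n (M : T -> 'M[Cplx R]_n) :
  (forall i j, cmeasurable (fun x => M x i j)) -> cmeasurable (fun x => \det (M x)).
Proof.
(* The determinant unfolds to the Leibniz sum over permutations. *)
move=> mM; apply: cmeasurable_sum => s; apply: cmeasurableM.
  exact: cmeasurable_cst.
exact: cmeasurable_prod.
Qed.

Lemma cmeasurable_expi (f : T -> R) : measurable_fun setT f ->
  cmeasurable (fun x => expi (f x)).
Proof.
move=> mf; split => /=; apply: measurableT_comp => //.
- by apply: continuous_measurable_fun; exact: continuous_cos.
- by apply: continuous_measurable_fun; exact: continuous_sin.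
Qed.

Lemma cmeasurable_of_real (f : T -> R) : measurable_fun setT f ->
  cmeasurable (fun x => of_real (f x)).
Proof. by move=> mf; split. Qed.

End ComplexMeasurability.

Lemma cmeasurable_comp (R : realType) d d' (T : measurableType d)
    (T' : measurableType d') (f : T -> T') (h : T' -> Cplx R) :
  measurable_fun setT f -> cmeasurable h -> cmeasurable (h \o f).
Proof.
move=> mf [hr hi]; split.
- exact: (measurableT_comp hr mf).
- exact: (measurableT_comp hi mf).
Qed.

(** * Borel sets of the plane and of matrix space *)

Lemma ltr_of_real (R : realType) (a b : R) : (of_real a < of_real b) = (a < b).
Proof. exact: ltcR. Qed.

Lemma normc_le_ReIm (R : realType) (z : Cplx R) :
  `|z| <= of_real (`|complex.Re z| + `|complex.Im z|).
Proof.
rewrite /of_real; case: z => a b; rewrite [leLHS]normc_def /= lecR.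
rewrite -[leRHS]ger0_norm ?addr_ge0 // -sqrtr_sqr ler_wsqrtr // sqrrD.
rewrite !real_normK ?num_real //.
by rewrite addrAC lerDl mulrn_wge0 ?mulr_ge0.
Qed.

Lemma normc_ge_Im (R : realType) (z : Cplx R) : of_real `|complex.Im z| <= `|z|.
Proof.
rewrite /of_real; case: z => a b; rewrite [leRHS]normc_def /= lecR.
by rewrite -sqrtr_sqr ler_wsqrtr // lerDr sqr_ge0.
Qed.

(* Rational rectangles form a countable base of the plane. *)
Lemma cmeasurable_borel (R : realType) d (T : measurableType d) (h : T -> Cplx R) :
  cmeasurable h ->
  measurable_fun setT (h : T -> borelType (Cplx R)).
Proof.
move=> [mr mi].
apply: (@measurability _ _ _ (borelType (Cplx R)) _ _ (@open (Cplx R))) => //.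
move=> _ [U oU <-]; rewrite setTI.
pose box (q : rat * rat * rat) : set T :=
  [set x | (`|complex.Re (h x) - ratr q.1.1| < ratr q.2) &&
           (`|complex.Im (h x) - ratr q.1.2| < ratr q.2)].
pose good (q : rat * rat * rat) := forall a b : R,
  `|a - ratr q.1.1| < ratr q.2 -> `|b - ratr q.1.2| < ratr q.2 -> U (a +i* b)%C.
have -> : h @^-1` U = \bigcup_(q in [set q | good q]) box q.
  apply/seteqP; split => [x Ux|x [q gq /andP[q1 q2]]]; last first.
    by have := gq _ _ q1 q2; rewrite /preimage /=; case: (h x).
  have : nbhs (h x) U by exact: open_nbhs_nbhs.
  move=> /nbhs_ballP[e e0 eU].
  (* Ball radii are elements of the complex field; a positive one is real. *)
  have eRe : e = of_real (complex.Re e).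
    rewrite /of_real; have /ger0_Im e0' := ltW e0.
    by case: (e) e0' => ? ? /= ->.
  have {}e0 : 0 < complex.Re e.
    by rewrite -ltr_of_real -eRe.
  (* Both [h x] and the new point lie within [r] of the rational centre in each coordinate, hence
     within [2 r] of each other; the two coordinates add up to [4 r], which must stay below [e]. *)
  have : (0 : R) < complex.Re e / 4 by rewrite divr_gt0.
  move=> /rat_in_itvoo[r]; rewrite in_itv /= => /andP[r0 re].
  have : complex.Re (h x) - ratr r < complex.Re (h x) by rewrite ltrBlDr ltrDl.
  move=> /rat_in_itvoo[a]; rewrite in_itv /= => /andP[a1 a2].
  have : complex.Im (h x) - ratr r < complex.Im (h x) by rewrite ltrBlDr ltrDl.
  move=> /rat_in_itvoo[b]; rewrite in_itv /= => /andP[b1 b2].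
  exists (a, b, r) => /=; last first.
    by rewrite /box /= !ger0_norm ?subr_ge0 ?ltW //; apply/andP; split; lra.
  move=> u v /= ua vb; apply: eU.
  rewrite -ball_normE /= (le_lt_trans (normc_le_ReIm _)) // eRe ltr_of_real.
  move: a1 a2 b1 b2 ua vb; case: (h x) => p s /= a1 a2 b1 b2.
  rewrite !ltr_norml => /andP[ua1 ua2] /andP[vb1 vb2].
  have h1 : `|p - u| < ratr r *+ 2.
    by rewrite ltr_norml; apply/andP; split; lra.
  have h2 : `|s - v| < ratr r *+ 2.
    by rewrite ltr_norml; apply/andP; split; lra.
  by move: h1 h2; rewrite !mulr2n => h1 h2; lra.
rewrite bigcup_mkcond; apply: countable_bigcupT_measurable => // q.
case: ifP => // _; rewrite /box -[X in measurable X]setTI.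
suff : measurable_fun setT (fun x => (`|complex.Re (h x) - ratr q.1.1| < ratr q.2)
    && (`|complex.Im (h x) - ratr q.1.2| < ratr q.2)).
  by move=> /(_ measurableT [set true]); apply.
apply: measurable_and; apply: measurable_fun_ltr => //.
- by apply: measurableT_comp => //; apply: measurable_funB.
- by apply: measurableT_comp => //; apply: measurable_funB.
Qed.

Lemma cmeasurable_preimage (R : realType) d (T : measurableType d) (h : T -> Cplx R)
    (A : set (borelType (Cplx R))) :
  cmeasurable h -> measurable A -> measurable (h @^-1` A).
Proof.
by move=> mh mA; rewrite -[X in measurable X]setTI; exact: (cmeasurable_borel mh).
Qed.

(** Real and imaginary parts are 1-Lipschitz and coordinates are continuous, so preimages of open
    rays are open sets of matrices. *)
Lemma cmeasurable_entry (R : realType) n (i j : 'I_n) :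
  cmeasurable (fun M : borelType 'M[Cplx R]_n => (M : 'M[Cplx R]_n) i j).
Proof.
have key (f : Cplx R -> R) : (forall u v, of_real `|f u - f v| <= `|u - v|) ->
    measurable_fun setT (fun M : borelType 'M[Cplx R]_n => f ((M : 'M[Cplx R]_n) i j)).
  move=> fL; apply: (measurability _ (RGenOInfty.measurableE R)) => //.
  move=> _ [_ [a ->] <-]; rewrite setTI.
  have oU : open [set z : Cplx R | a < f z].
    rewrite openE => z /= az; apply/nbhs_ballP; exists (of_real (f z - a)).
      by have := ltr_of_real 0 (f z - a); rewrite subr_gt0 az.
    move=> w; rewrite -ball_normE /= => /(le_lt_trans (fL _ _)).
    by rewrite ltr_of_real => /(le_lt_trans (ler_norm _)); lra.
  have oV : open [set M : 'M[Cplx R]_n | a < f (M i j)].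
    by apply: (open_comp _ oU) => M _; exact: coord_continuous.
  apply: sub_sigma_algebra; congr (open _): oV.
  by apply/seteqP; split => M /=; rewrite in_itv /= andbT.
split; apply: key => u v.
- have -> : complex.Re u - complex.Re v = complex.Re (u - v) by case: u v => ? ? [].
  exact: normc_ge_Re.
- have -> : complex.Im u - complex.Im v = complex.Im (u - v) by case: u v => ? ? [].
  exact: normc_ge_Im.
Qed.

(** * Rotation invariance of the uniform law on the circle *)

Section UniformPhase.
Context (R : realType).
Local Notation leb := (@lebesgue_measure R).

Lemma measurable_shift (a : R) : measurable_fun setT (fun x : R => x + a).
Proof. exact: measurable_funD. Qed.

Lemma measurable_shift_preimage (a : R) (A : set R) :
  measurable A -> measurable ((fun x => x + a) @^-1` A).
Proof. by move=> mA; rewrite -[X in measurable X]setTI; exact: measurable_shift. Qed.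

(** The pushforward under a translation agrees with Lebesgue measure on half-open intervals, and
    this determines it. *)
Lemma lebesgue_measure_shift (a : R) (A : set R) : measurable A ->
  leb ((fun x => x + a) @^-1` A) = leb A.
Proof.
move=> mA; rewrite -[LHS]/(pushforward leb ((fun x => x + a) : _ -> measurableTypeR R) A).
apply/esym; apply: lebesgue_measure_unique => //=.
  exact: measurable_shift.
move=> _ _ [[u v]] /= _ <-; rewrite /pushforward.
have -> : (fun x => x + a) @^-1` `]u, v] = `]u - a, v - a]%classic.
  by apply/seteqP; split => x /=; rewrite !in_itv /= ltrBlDr lerBrDr.
rewrite !lebesgue_measure_itv /= !lte_fin ltrD2r.
by case: ifP => // _; rewrite -!EFinB; congr EFin; ring.
Qed.

(** The uniform density lives on a closed interval; dropping the null endpoint gives a half-open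
    one, whose translates by the period tile the line. *)
Lemma uniform_probE (A : set R) : measurable A ->
  uniform_prob (twopi_gt0 R) A = (((2 * pi)^-1)%:E * leb (A `&` `[0%R, (2 * pi)%R[%classic))%E.
Proof.
move=> mA; rewrite /uniform_prob integral_uniform_pdf.
have mI b : measurable (A `&` [set` Interval (BLeft 0) (BSide b (2 * pi))]) by exact: measurableI.
rewrite (eq_integral (fun=> ((2 * pi)^-1)%:E)); last first.
  by move=> x; rewrite inE /= => -[_]; rewrite in_itv /= /uniform_pdf subr0 => h; rewrite h.
rewrite integral_cst //; last exact: (mI false).
congr (_ * _)%E; apply/eqP; rewrite eq_le; apply/andP; split.
- rewrite -[leRHS]adde0 -(lebesgue_measure_set1 (2 * pi)).
  apply: (@le_trans _ _ (leb ((A `&` `[0%R, (2 * pi)%R[%classic) `|` [set 2 * pi]))).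
    apply: le_measure; rewrite ?inE; [exact: (mI false)| |].
      by apply: measurableU => //; exact: (mI true).
    move=> x [Ax]; rewrite /= !in_itv /= => /andP[x0].
    rewrite le_eqVlt => /orP[/eqP|x1]; [by right|left].
    by split => //; apply/andP.
  by apply: measureU2 => //; exact: (mI true).
- apply: le_measure; rewrite ?inE; [exact: (mI true)|exact: (mI false)|]; apply: setIS => x; rewrite /= !in_itv /=.
  by move=> /andP[-> /ltW].
Qed.

(** After reducing the shift modulo [2 * pi], the shifted period sticks out of the original one on
    the right; the protruding piece is moved back by one period, which leaves [A] invariant. *)
Lemma uniform_prob_periodic (A : set R) (a : R) : measurable A ->
  (forall x, A (x + 2 * pi) <-> A x) ->
  uniform_prob (twopi_gt0 R) ((fun x => x + a) @^-1` A) =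
  uniform_prob (twopi_gt0 R) A.
Proof.
move=> mA perA; set T := 2 * pi.
have T0 : 0 < T by exact: twopi_gt0.
have perN n x : A (x + n%:R * T) <-> A x.
  elim: n x => [|n IH] x; first by rewrite mul0r addr0.
  by rewrite -natr1 mulrDl mul1r addrA perA IH.
have perZ (k : int) x : A (x + k%:~R * T) <-> A x.
  case: k => n; first exact: perN.
  by rewrite NegzE mulrNz mulNr -(perN n.+1 (x - _)) subrK.
(* [b] is the representative of [a] in [[0, T[]; it acts on the periodic set [A] exactly as [a]
   does. *)
pose b := a - (Num.floor (a / T))%:~R * T.
have /andP[b0 bT] : 0 <= b < T.
  have := floor_itv (a / T) ; rewrite /b.
  rewrite ler_pdivlMr // ltr_pdivrMr // intrD mulrDl mul1r.
  by move=> /andP[h1 h2]; apply/andP; split; lra.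
have -> : (fun x => x + a) @^-1` A = (fun x => x + b) @^-1` A.
  by apply/seteqP; split => x /=; rewrite -(perZ (Num.floor (a / T)) (x + b)) /b -addrA subrK.
rewrite !uniform_probE //; last exact: measurable_shift_preimage.
congr (_ * _)%E.
have sh c (I J : set R) : measurable J -> I = (fun x => x + c) @^-1` J ->
    leb ((fun x => x + c) @^-1` A `&` I) = leb (A `&` J).
  move=> mJ ->; rewrite -preimage_setI lebesgue_measure_shift //.
  exact: measurableI.
rewrite (sh b _ `[b, (T + b)[%classic) //; last first.
  by apply/seteqP; split => x /=; rewrite !in_itv /= lerDr ltrD2r.
have split c d e : 0 <= d - c -> 0 <= e - d ->
    leb (A `&` `[c, e[) = (leb (A `&` `[c, d[%classic) + leb (A `&` `[d, e[%classic))%E.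
  move=> cd de; rewrite -measureU; try exact: measurableI; last first.
    apply/seteqP; split => // x [[_ +] [_]] /=; rewrite !in_itv /=.
    by move=> /andP[_ h1] /andP[h2 _]; have : x < x := lt_le_trans h1 h2; rewrite ltxx.
  congr leb; rewrite -setIUr; congr (_ `&` _).
  apply/seteqP; split => x /=; rewrite !in_itv /=.
    by move=> /andP[h1 h2]; have [h|h] := ltP x d; [left|right]; apply/andP.
  by move=> [] /andP[h1 h2]; apply/andP; split; lra.
rewrite (split b T); [|lra|lra].
rewrite (split 0 b T); [|lra|lra].
rewrite addeC; congr (_ + _)%E.
(* Only the wrapped-around piece remains: [[T, T + b[] is translated back to [[0, b[]. *)
rewrite -(sh T `[0, b[%classic) //; last first.
  apply/seteqP; split => x /=; rewrite !in_itv /= => /andP[h1 h2];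
  by apply/andP; split; lra.
congr (leb (_ `&` _)); apply/seteqP; split => x; by rewrite /= perA.
Qed.

End UniformPhase.

(** * Fubini for a pair of independent variables *)

(** Independence makes the joint law the product of the marginals, whose value on a set is the
    integral of the measures of its sections; equal section measures therefore give equal
    probabilities. *)
Lemma indep_xsection_eq (R : realType) d d1 d2 (T : measurableType d)
    (T1 : measurableType d1) (T2 : measurableType d2) (P : probability T R)
    (X : T -> T1) (Y : T -> T2) (C D : set (T1 * T2)) :
  measurable_fun setT X -> measurable_fun setT Y ->
  (forall A B, measurable A -> measurable B ->
     P (X @^-1` A `&` Y @^-1` B) = (P (X @^-1` A) * P (Y @^-1` B))%E) ->
  measurable C -> measurable D ->
  (forall x, P (Y @^-1` xsection C x) = P (Y @^-1` xsection D x)) ->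
  P [set w | C (X w, Y w)] = P [set w | D (X w, Y w)].
Proof.
move=> mX mY XY mC mD CD.
have mXY : measurable_fun setT (fun w => (X w, Y w)).
  exact/measurable_fun_pair.
pose X' : {RV P >-> T1} := mfun_Sub (mem_set mX).
pose Y' : {RV P >-> T2} := mfun_Sub (mem_set mY).
pose XY' : {RV P >-> (T1 * T2)%type} := mfun_Sub (mem_set mXY).
have law E : measurable E ->
    (distribution P X' \x distribution P Y')%E E = P [set w | E (X w, Y w)].
  move=> mE; apply: (product_measure_unique (m' := distribution P XY')) => //.
rewrite -(law C mC) -(law D mD); apply: eq_integral => x _; exact: CD.
Qed.

(** * Independence of one variable from the sigma-algebra of the others *)

Section IndependentBlock.
Context (R : realType) d (T : measurableType d) (P : probability T R).
Context (I : finType) (W : I -> {RV P >-> R}).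

Definition generators (J : {set I}) : set (set T) :=
  [set C | exists i B, [/\ i \in J, measurable (B : set R) & C = W i @^-1` B]].

(** A pi-system containing [generators J], on which mutual independence can be applied directly. *)
Let rectangles (J : {set I}) : set (set T) :=
  [set C | exists2 B : I -> set R, (forall i, measurable (B i)) &
    C = \bigcap_(i in [set` J]) (W i @^-1` B i)].

Lemma measurable_rv_preimage i (B : set R) : measurable B -> measurable (W i @^-1` B).
Proof. by move=> mB; rewrite -[X in measurable X]setTI; exact: measurable_funP. Qed.

Lemma generators_measurable J : generators J `<=` measurable.
Proof. by move=> _ [i [B [_ mB ->]]]; exact: measurable_rv_preimage. Qed.

Lemma sigma_generators_measurable J : <<s generators J >> `<=` measurable.
Proof.
by apply: smallest_sub; [exact: sigma_algebra_measurable|exact: generators_measurable].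
Qed.

Let rectangles_measurable J : rectangles J `<=` measurable.
Proof.
move=> _ [B mB ->]; apply: fin_bigcap_measurable => // i _.
exact: measurable_rv_preimage.
Qed.

Let rectanglesI J : setI_closed (rectangles J).
Proof.
move=> _ _ [B mB ->] [C mC ->]; exists (fun i => B i `&` C i).
  by move=> i; exact: measurableI.
by rewrite -bigcapI; apply: eq_bigcapr => i _; rewrite preimage_setI.
Qed.

Let generators_rectangles J : generators J `<=` rectangles J.
Proof.
move=> _ [i [B [iJ mB ->]]]; exists (fun j => if j == i then B else setT).
  by move=> j; case: ifP.
apply/seteqP; split => [w Bw j _ /=|w /(_ i iJ) /=]; last by rewrite eqxx.
by case: eqP => [->|].
Qed.

Hypothesis indepW : mutually_independent W.

(** As functions of [G], both sides are finite measures agreeing on the pi-system of rectangles,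
    hence on the sigma-algebra it generates. *)
Lemma indep_block (J : {set I}) (i0 : I) (G : set T) (A : set R) :
  i0 \notin J -> <<s generators J >> G -> measurable A ->
  P (G `&` W i0 @^-1` A) = (P G * P (W i0 @^-1` A))%E.
Proof.
move=> i0J sG mA.
have mD := measurable_rv_preimage i0 mA.
have PDfin : P (W i0 @^-1` A) \is a fin_num by exact: fin_num_measure.
have r0 : 0 <= fine (P (W i0 @^-1` A)) by exact: fine_ge0.
(* A restricted measure on the left and a scaled one on the right, as the uniqueness theorem
   requires. *)
rewrite -[LHS]/(mrestr P mD G) -(fineK PDfin) muleC -[RHS]/(mscale (NngNum r0) P G).
apply: (g_sigma_algebra_measure_unique (rectangles J) _ (fun=> setT)) => //.
- move=> _; exists (fun=> setT) => //; apply/seteqP; split => // w _ i _.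
- by rewrite bigcup_const //; exists 0%N.
- move=> _ [B mB ->].
  set X := \bigcap_(i in _) _.
  rewrite -[LHS]/(P (X `&` W i0 @^-1` A)).
  rewrite -[RHS]/((fine (P (W i0 @^-1` A)))%:E * P X)%E fineK // muleC /X {X}.
  (* The rectangle over [J] is extended by the side [A] at [i0], so that independence over [i0 |: J]
     and over [J] can be compared. *)
  pose B' i := if i == i0 then A else B i.
  have mB' i : measurable (B' i) by rewrite /B'; case: ifP.
  have B'J i : i \in J -> B' i = B i.
    by move=> iJ; rewrite /B'; case: eqP => // ii0; rewrite -ii0 iJ in i0J.
  have B'0 : B' i0 = A by rewrite /B' eqxx.
  have := indepW (i0 |: J) mB'; rewrite big_setU1 //= B'0.
  under eq_bigr do rewrite B'J //.
  rewrite -(indepW J mB) muleC => <-; congr (P _).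
  apply/seteqP; split => [w [Bw Aw] i /=|w Hw]; last split.
  + by rewrite !inE => /orP[/eqP ->|iJ]; rewrite ?B'0 ?B'J //; exact: Bw.
  + by move=> i iJ; rewrite /= -B'J //; apply: Hw; rewrite /= !inE iJ orbT.
  + by rewrite -B'0; apply: Hw; rewrite /= !inE eqxx.
- move=> _.
  exact: le_lt_trans (probability_le1 P (measurableI _ _ measurableT mD)) (ltry _).
- exact: (@sub_sigma_algebra2 _ setT _ _ (@generators_rectangles J) _ sG).
Qed.

(** The sample space with the coarser sigma-algebra of the variables in [J]: being measurable on
    [past J] encodes depending on those variables only. *)
Definition past (J : {set I}) := g_sigma_algebraType (generators J).

Lemma measurable_past_rv (J : {set I}) i : i \in J ->
  measurable_fun setT (W i : past J -> R).
Proof.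
by move=> iJ _ B mB; rewrite setTI; apply: sub_sigma_algebra; exists i, B.
Qed.

Lemma measurable_past (J K : {set I}) : J \subset K ->
  measurable_fun setT (id : past K -> past J).
Proof.
move=> JK _ B mB; rewrite setTI; apply: sub_sigma_algebra2 mB.
by move=> _ [i [C [iJ mC ->]]]; exists i, C; split => //; exact: (fintype.subsetP JK).
Qed.

Lemma measurable_to_past (J : {set I}) : measurable_fun setT (id : T -> past J).
Proof. by move=> _ B mB; rewrite setTI; exact: sigma_generators_measurable mB. Qed.

Lemma skew_shift (J : {set I}) (i0 : I) (H : T -> R -> Cplx R) (alpha : T -> R)
    (A : set (borelType (Cplx R))) :
  i0 \notin J -> uniform_phase (W i0) ->
  (forall w t, H w (t + 2 * pi) = H w t) ->
  cmeasurable (fun p : past J * R => H p.1 p.2) ->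
  measurable_fun setT (alpha : past J -> R) ->
  measurable A ->
  P [set w | A (H w (W i0 w + alpha w))] = P [set w | A (H w (W i0 w))].
Proof.
move=> i0J unif perH mH malpha mA.
pose D : set (past J * R) := (fun p => H p.1 p.2) @^-1` A.
have mD : measurable D by exact: cmeasurable_preimage.
pose C : set (past J * R) := (fun p => H p.1 (p.2 + alpha p.1)) @^-1` A.
have mC : measurable C.
  apply: cmeasurable_preimage mA.
  apply: (cmeasurable_comp (f := fun p : past J * R => (p.1, p.2 + alpha p.1)) _ mH).
  apply: measurable_fun_pair; first exact: measurable_fst.
  apply: measurable_funD; first exact: measurable_snd.
  by apply: (measurableT_comp malpha); exact: measurable_fst.
(* The sample point itself, seen in [past J], serves as the first variable of the pair. *)
apply: (indep_xsection_eq (X := id : T -> past J) (Y := W i0) (C := C) (D := D)) => //.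
- exact: measurable_to_past.
- by move=> G B mG mB; apply: (indep_block i0J).
- move=> w.
  have Px (E : set (past J * R)) : measurable E ->
      P (W i0 @^-1` xsection E w) = uniform_prob (twopi_gt0 R) (xsection E w).
    by move=> mE; rewrite -unif; [|exact: measurable_xsection].
  rewrite !Px //.
  have -> : xsection C w = (fun t => t + alpha w) @^-1` xsection D w.
    by apply/seteqP; split => t; rewrite /xsection /= !inE.
  apply: uniform_prob_periodic; first exact: measurable_xsection.
  by move=> t; rewrite /xsection /= !inE /D /= perH.
Qed.

End IndependentBlock.

(** * Determinants of weighted permutation matrices *)

Section PhasePermDet.
Context (K : comNzRingType).

Definition wperm n (s : 'S_n) (z : 'I_n -> K) : 'M[K]_n :=
  \matrix_(i, j) (z j * (j == s i)%:R).

Lemma eq_wperm n (s : 'S_n) (z z' : 'I_n -> K) : z =1 z' -> wperm s z = wperm s z'.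
Proof. by move=> zz'; apply/matrixP => i j; rewrite !mxE zz'. Qed.

Lemma expand_det_max n (M : 'M[K]_n.+1) :
  (forall j, M ord_max j = (j == ord_max)%:R * M ord_max ord_max) ->
  \det M = M ord_max ord_max * \det (\matrix_(i, j) M (lift ord_max i) (lift ord_max j)).
Proof.
move=> M0; rewrite (expand_det_row _ ord_max) (bigD1 ord_max) //= big1 => [|j /negPf jm].
  rewrite addr0 /cofactor addnn -signr_odd odd_double expr0 mul1r; congr (_ * \det _).
  by apply/matrixP => i j; rewrite !mxE.
by rewrite M0 jm mul0r mul0r.
Qed.

(** When the last index is fixed, the last row is zero off the diagonal and the determinant
    factors. *)
Lemma det_wperm_fix n (s : 'S_n) (z : 'I_n.+1 -> K) :
  \det (1%:M - wperm (lift_perm ord_max ord_max s) z) =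
  (1 - z ord_max) * \det (1%:M - wperm s (z \o lift ord_max)).
Proof.
rewrite expand_det_max => [|j].
  rewrite !mxE lift_perm_id !eqxx mulr1; congr (_ * \det _).
  by apply/matrixP => i j; rewrite !mxE lift_perm_lift !(inj_eq lift_inj).
rewrite !mxE lift_perm_id (eq_sym ord_max j).
by case: eqP => [->|_]; rewrite ?eqxx ?mulr0 ?mulr1 ?mul1r ?mul0r ?subr0.
Qed.

(* Adding [z j] times the last column to column [j] clears the last row: the last
   index, which sits just before [j] in its cycle, is removed and its weight is
   absorbed by [j]. *)
Lemma det_wperm_tperm n (s : 'S_n) (j : 'I_n) (z : 'I_n.+1 -> K) :
  \det (1%:M - wperm (lift_perm ord_max ord_max s * tperm (lift ord_max j) ord_max) z) =
  \det (1%:M - wperm s (fun k => if k == j then z (lift ord_max k) * z ord_max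
                                 else z (lift ord_max k))).
Proof.
set r := (_ * _)%g; set lj := lift ord_max j.
have ljm : (lj == ord_max) = false by rewrite eq_sym (negPf (neq_lift _ _)).
have rmax : r ord_max = lj by rewrite permM lift_perm_id tpermR.
have rlift k : r (lift ord_max k) = if s k == j then ord_max else lift ord_max (s k).
  rewrite permM lift_perm_lift; case: eqP => [->|skj]; first by rewrite tpermL.
  by rewrite tpermD ?neq_lift // (inj_eq lift_inj) eq_sym; apply/eqP.
pose E : 'M[K]_n.+1 := 1%:M + z lj *: delta_mx ord_max lj.
(* [E] is the unitriangular matrix of the column operation. *)
have detE : \det E = 1.
  rewrite det_trig; last first.
    apply/is_trig_mxP => a b ab; rewrite !mxE.
    have -> : (a == b) = false by exact: ltn_eqF ab.
    have -> : (a == ord_max) = false by exact: ltn_eqF (leq_trans ab (leq_ord b)).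
    by rewrite mulr0 addr0.
  apply: big1 => a _; rewrite !mxE eqxx; case: (eqVneq a ord_max) => [->|_] /=.
    by rewrite (eq_sym _ lj) ljm mulr0 addr0.
  by rewrite mulr0 addr0.
have -> : \det (1%:M - wperm r z) = \det ((1%:M - wperm r z) *m E).
  by rewrite det_mulmx detE mulr1.
have entry a b : ((1%:M - wperm r z) *m E) a b =
    (a == b)%:R - z b * (b == r a)%:R
    + z lj * ((a == ord_max)%:R - z ord_max * (ord_max == r a)%:R) * (b == lj)%:R.
  rewrite mulmxDr mulmx1 -scalemxAr !mxE (bigD1 ord_max) //= big1 => [|k /negPf km].
    by rewrite !mxE eqxx addr0 mulrA.
  by rewrite !mxE km mulr0.
rewrite expand_det_max => [|b]; last first.
  rewrite !entry rmax eqxx (eq_sym ord_max lj) ljm !(eq_sym ord_max) !mulr0 !subr0.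
  rewrite mulr1 addr0 mulr1; case: (eqVneq b lj) => [->|_].
    by rewrite ljm !mulr1 sub0r addNr.
  by rewrite !mulr0 subr0 addr0.
rewrite entry rmax eqxx !(eq_sym ord_max lj) ljm !mulr0 !subr0 addr0 mul1r.
congr (\det _); apply/matrixP => a b; rewrite mxE entry !mxE rlift !(inj_eq lift_inj).
rewrite [_ == ord_max]eq_sym (negPf (neq_lift _ _)) sub0r.
(* The row that [s] sends to [j] passes through the last index under [r]; the column operation puts
   the product of the two weights into its column [j]. *)
case: (eqVneq (s a) j) => [saj|saj].
  rewrite saj eqxx [_ == ord_max]eq_sym (negPf (neq_lift _ _)) mulr0 subr0.
  case: (eqVneq b j) => [->|_]; last by rewrite !mulr0 addr0 subr0.
  by rewrite !mulr1 mulrN.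
rewrite (negPf (neq_lift _ _)) mulr0 oppr0 mulr0 mul0r addr0 (inj_eq lift_inj).
case: (eqVneq b j) => [->|//].
by rewrite ![j == s a]eq_sym (negPf saj) !mulr0.
Qed.
End PhasePermDet.

(** * Enumeration of permutations, periodicity of phases and Bernoulli splitting *)

(** A permutation is determined by the image [j] of the last point together with the permutation
    fixing that point obtained by composing with the transposition of [j] and the last point.
    Injectivity and a count of both sides make this a bijection; [j] equal to the last point gives
    the separate term. *)
Lemma big_perm_recr (V : Type) (idx : V) (op : Monoid.com_law idx) n (F : 'S_n.+1 -> V) :
  \big[op/idx]_s F s =
  \big[op/idx]_(s : 'S_n) op (\big[op/idx]_(j < n)
      F (lift_perm ord_max ord_max s * tperm (lift ord_max j) ord_max)%g)
    (F (lift_perm ord_max ord_max s)).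
Proof.
pose L (s : 'S_n) := lift_perm ord_max ord_max s.
pose h (p : 'S_n * 'I_n.+1) := (L p.1 * tperm p.2 ord_max)%g.
have h_inj : injective h.
  move=> [s j] [s' j'] /= hE.
  have jE : j = j'.
    by have := congr1 (fun t : 'S_n.+1 => t ord_max) hE; rewrite !permM !lift_perm_id !tpermR.
  move: hE; rewrite /h /= jE => /mulIg LE; congr pair.
  apply/permP => k; apply: (@lift_inj _ ord_max).
  by rewrite -!(lift_perm_lift ord_max ord_max) -!/(L _) LE.
have h_bij : bijective h.
  by apply: inj_card_bij h_inj _; rewrite card_prod card_ord !card_Sn factS mulnC.
rewrite (reindex h) /=; last exact: onW_bij.
rewrite -(pair_big xpredT xpredT (fun s j => F (L s * tperm j ord_max)%g)) /=.
apply: eq_bigr => s _; rewrite big_ord_recr /=; congr (op _ _).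
  apply: eq_bigr => j _; congr (F (_ * tperm _ _)%g).
  by apply/val_inj; rewrite /= /bump leqNgt ltn_ord.
by rewrite tperm1 mulg1.
Qed.

Lemma expiD (R : realType) (a b : R) : expi (a + b) = expi a * expi b.
Proof.
rewrite -[RHS]/((cos a * cos b - sin a * sin b) +i* (cos a * sin b + sin a * cos b))%C.
by rewrite /expi cosD sinD (addrC (sin a * cos b)).
Qed.

Lemma expiD2pi (R : realType) (a : R) : expi (a + 2 * pi) = expi a.
Proof. by rewrite /expi mulr_natl cosD2pi sinD2pi. Qed.

Lemma eq_event (T U : Type) (A : set U) (f g : T -> U) :
  f =1 g -> [set w | A (f w)] = [set w | A (g w)].
Proof. by move=> /funext ->. Qed.

(** The two probabilities add up to 1, so the event that [X] takes another value is null. *)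
Lemma bernoulli_split (R : realType) d (T : measurableType d) (P : probability T R)
    (X : {RV P >-> R}) (p : R) (E : set T) :
  bernoulli_rv X p -> measurable E ->
  P E = (P (E `&` X @^-1` [set 1%R]) + P (E `&` X @^-1` [set 0%R]))%E.
Proof.
move=> [X1 X0] mE.
have mX r : measurable (X @^-1` [set r]).
  by rewrite -[X in measurable X]setTI; exact: measurable_funP.
have D01 : X @^-1` [set 1] `&` X @^-1` [set 0] = set0.
  by apply/seteqP; split => // w [/= -> /eqP]; rewrite oner_eq0.
set D := X @^-1` [set 1] `|` X @^-1` [set 0].
have mD : measurable D by exact: measurableU.
have PD : P (~` D) = 0%E.
  have -> : P (~` D) = (1 - P D)%E by exact: probability_setC.
  have -> : P D = (P (X @^-1` [set 1%R]) + P (X @^-1` [set 0%R]))%E by exact: measureU.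
  by rewrite X1 X0 -EFinD; congr EFin; ring.
have PED : P (E `\` D) = 0%E.
  apply/eqP; rewrite eq_le measure_ge0 andbT -PD.
  by apply: le_measure; rewrite ?inE //; [exact: measurableD|exact: measurableC].
have -> : P E = (P (E `\` D) + P (E `&` D))%E by exact: measureDI.
rewrite PED add0e /D setIUr.
apply: measureU; try exact: measurableI.
by rewrite setIACA D01 setI0.
Qed.

Lemma widen_lift_max n N (le : (n.+1 <= N)%N) (k : 'I_n) :
  widen_ord le (lift ord_max k) = widen_ord (ltnW le) k.
Proof. by apply/val_inj; exact: lift_max. Qed.

(** * Induction on the size, with independent uniform phases *)

Section ClaimInduction.
Context (R : realType) (N : nat) d (T : measurableType d) (P : probability T R).
Context (theta X : 'I_N -> {RV P >-> R}).
Hypothesis htheta : forall k, uniform_phase (theta k).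
Hypothesis hX : forall k : 'I_N, bernoulli_rv (X k) (k.+1%:R^-1).

Let W (i : 'I_N + 'I_N) := match i with inl k => theta k | inr k => X k end.
Hypothesis indepW : mutually_independent W.

(** The variables attached to indices already removed; the prefactor accumulated in the induction
    may depend on these only. *)
Definition later n : {set 'I_N + 'I_N} :=
  [set i : 'I_N + 'I_N | (n <= match i with inl k => k : nat | inr k => k : nat end)%N].

Lemma cmeasurable_past_expi (J : {set 'I_N + 'I_N}) k : inl k \in J ->
  cmeasurable (fun w : past W J => expi (theta k w)).
Proof. by move=> kJ; apply: cmeasurable_expi; exact: (measurable_past_rv (W := W) kJ). Qed.

Lemma cmeasurable_past_of_real (J : {set 'I_N + 'I_N}) k : inr k \in J ->
  cmeasurable (fun w : past W J => of_real (X k w)).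
Proof. by move=> kJ; apply: cmeasurable_of_real; exact: (measurable_past_rv (W := W) kJ). Qed.

Lemma cmeasurable_past_le (J K : {set 'I_N + 'I_N}) (h : T -> Cplx R) : J \subset K ->
  cmeasurable (h : past W J -> Cplx R) -> cmeasurable (h : past W K -> Cplx R).
Proof. by move=> JK; apply: cmeasurable_comp; exact: measurable_past. Qed.

Lemma later_lt n (i : 'I_N + 'I_N) :
  (match i with inl k => k : nat | inr k => k : nat end < n)%N ->
  later n \subset ~: [set i].
Proof.
move=> i_n; apply/fintype.subsetP => j; rewrite !inE; apply: contraTneq => ->.
by rewrite -ltnNge.
Qed.

Lemma later_sub n : later n.+1 \subset later n.
Proof. by apply/fintype.subsetP => i; rewrite !inE => /ltnW. Qed.

(** Multiplying the weight of [j] by that of the last index rotates the phase of [j] by an angle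
    depending on other variables. Nothing else in the expression involves the phase of [j], so
    [skew_shift] removes the rotation. *)
Lemma absorb_phase n (le : (n.+1 <= N)%N) (s : 'S_n) (j : 'I_n) (Y : T -> Cplx R)
    (A : set (borelType (Cplx R))) :
  cmeasurable (Y : past W (later n.+1) -> Cplx R) -> measurable A ->
  let z k w := expi (theta (widen_ord le k) w) in
  P [set w | A (Y w * \det (1%:M - wperm s (fun k =>
      if k == j then z (lift ord_max k) w * z ord_max w else z (lift ord_max k) w)))] =
  P [set w | A (Y w * \det (1%:M - wperm s (fun k => z (lift ord_max k) w)))].
Proof.
move=> mY mA z.
pose H w (t : R) := Y w * \det (1%:M - wperm s (fun k =>
  if k == j then expi t else z (lift ord_max k) w)).
pose i0 : 'I_N + 'I_N := inl (widen_ord (ltnW le) j).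
(* Everything except the phase of [j] is frozen; this includes the last phase, which plays
   [alpha]. *)
pose J := ~: [set i0].
have wi k : k != j -> inl (widen_ord (ltnW le) k) \in J.
  by rewrite !inE; apply: contraNneq => -[/val_inj ->].
have wm : inl (widen_ord le ord_max) \in J.
  by rewrite !inE; apply/eqP => -[] /eqP; rewrite gtn_eqF.
have i0J : i0 \notin J by rewrite !inE eqxx.
have laterJ : later n.+1 \subset J.
  by apply: later_lt; rewrite /= ltnS ltnW.
have mH : cmeasurable (fun p : past W J * R => H p.1 p.2).
  apply: cmeasurableM.
    apply: (cmeasurable_comp (f := fst : past W J * R -> past W J)).
      exact: measurable_fst.
    exact: cmeasurable_past_le mY.
  apply: cmeasurable_det => a b.
  under [X in cmeasurable X]eq_fun do rewrite !mxE.
  apply: cmeasurableD; first exact: cmeasurable_cst.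
  apply: cmeasurableN; apply: cmeasurableM; last exact: cmeasurable_cst.
  case: eqVneq => [_|bj]; first by apply: cmeasurable_expi; exact: measurable_snd.
  apply: (cmeasurable_comp (f := fst : past W J * R -> past W J)
    (h := fun w : past W J => z (lift ord_max b) w)); first exact: measurable_fst.
  by rewrite /z widen_lift_max; apply: cmeasurable_past_expi; exact: wi.
have perH w t : H w (t + 2 * pi) = H w t by rewrite /H expiD2pi.
have malpha : measurable_fun setT (theta (widen_ord le ord_max) : past W J -> R).
  exact: (measurable_past_rv (W := W) wm).
have := skew_shift indepW i0J (htheta _) perH mH malpha mA.
rewrite /H /W /= => HE; etransitivity; [|etransitivity; [exact: HE|]].
- apply: (congr1 P); apply: eq_event => w; apply: (congr1 (fun M => _ * \det (_ - M)));
  apply: eq_wperm => k; case: eqP => [->|_]; last by [].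
  by rewrite /z widen_lift_max expiD.
- apply: (congr1 P); apply: eq_event => w; apply: (congr1 (fun M => _ * \det (_ - M)));
  apply: eq_wperm => k; case: eqP => [->|_]; last by [].
  by rewrite /z widen_lift_max.
Qed.

(** Condition on [X k]: on each of its two values [h] coincides with a function independent of
    [X k], so the probabilities multiply. *)
Lemma bernoulli_mixture k (h h0 h1 : T -> Cplx R) (A : set (borelType (Cplx R))) :
  cmeasurable h ->
  cmeasurable (h0 : past W (~: [set inr k]) -> Cplx R) ->
  cmeasurable (h1 : past W (~: [set inr k]) -> Cplx R) ->
  (forall w, X k w = 0 -> h w = h0 w) -> (forall w, X k w = 1 -> h w = h1 w) ->
  measurable A ->
  P (h @^-1` A) = ((k.+1%:R^-1)%:E * P (h1 @^-1` A)
                   + (1 - k.+1%:R^-1)%:E * P (h0 @^-1` A))%E.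
Proof.
move=> mh mh0 mh1 hh0 hh1 mA.
rewrite (bernoulli_split (hX k) (cmeasurable_preimage mh mA)).
have [X1 X0] := hX k.
have kJ : inr k \notin ~: [set inr k : 'I_N + 'I_N] by rewrite !inE eqxx.
have part (f : T -> Cplx R) (r : R) :
    cmeasurable (f : past W (~: [set inr k]) -> Cplx R) ->
    (forall w, X k w = r -> h w = f w) ->
    P (h @^-1` A `&` X k @^-1` [set r]) = (P (X k @^-1` [set r]) * P (f @^-1` A))%E.
  move=> mf hf; rewrite muleC.
  rewrite -[in RHS](indep_block indepW kJ (cmeasurable_preimage mf mA)) //.
  by apply: (congr1 P); apply/seteqP; split => w /= [+ Xr]; rewrite hf.
by congr (_ + _)%E; [rewrite (part h1)|rewrite (part h0)]; rewrite ?X1 ?X0.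
Qed.

(** Summing over all permutations against [n!] expresses a uniform permutation. The prefactor [Y]
    strengthens the induction: when the last index is fixed, its factor is moved into [Y], and the
    hypothesis for size [n] still applies. *)
Lemma wperm_sum_law n (le : (n <= N)%N) (Y : T -> Cplx R)
    (A : set (borelType (Cplx R))) :
  cmeasurable (Y : past W (later n) -> Cplx R) -> measurable A ->
  let z k w := expi (theta (widen_ord le k) w) in
  (\sum_(s : 'S_n) P [set w | A (Y w * \det (1%:M - wperm s (fun k => z k w)))%R] =
   n`!%:R%:E * P [set w | A (Y w * \prod_(k < n)
      (1 - z k w * of_real (X (widen_ord le k) w)))%R])%E.
Proof.
elim: n le Y => [|n IH] le Y mY mA z.
  rewrite (big_pred1 1%g) => [|s]; last by rewrite /= (permS0 s) eqxx.
  by rewrite mul1e; apply: (congr1 P); apply: eq_event => w; rewrite det_mx00 big_ord0.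
rewrite big_perm_recr /=.
have lift_widen k : widen_ord le (lift ord_max k) = widen_ord (ltnW le) k.
  exact: widen_lift_max.
have widen_widen k : widen_ord le (widen_ord (leqnSn n) k) = widen_ord (ltnW le) k.
  exact/val_inj.
pose z' k w := expi (theta (widen_ord (ltnW le) k) w).
pose Z w := Y w * (1 - z ord_max w).
have maxn : inl (widen_ord le ord_max) \in later n by rewrite inE /=.
have mY' : cmeasurable (Y : past W (later n) -> Cplx R).
  exact: cmeasurable_past_le (later_sub n) mY.
have mZ : cmeasurable (Z : past W (later n) -> Cplx R).
  apply: cmeasurableM => //; apply: cmeasurableD; first exact: cmeasurable_cst.
  by apply: cmeasurableN; exact: cmeasurable_past_expi.
(* Each [s] comes from [n] permutations in which the last index is absorbed, all with the same
   probability, and from one that fixes it and turns [Y] into [Z]. *)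
transitivity (\sum_(s : 'S_n)
   ((n%:R)%:E * P [set w | A (Y w * \det (1%:M - wperm s (fun k => z' k w)))%R]
    + P [set w | A (Z w * \det (1%:M - wperm s (fun k => z' k w)))%R]))%E.
  apply: eq_bigr => s _; congr (_ + _)%E.
  - rewrite (eq_bigr (fun=> P [set w | A (Y w * \det (1%:M - wperm s (fun k => z' k w)))%R])).
      rewrite big_const card_ord iter_addr_0 mule_natl //.
    move=> j _; have := @absorb_phase n le s j Y A mY mA; rewrite -/z => /= HE.
    etransitivity; [|etransitivity; [exact: HE|]].
    + by apply: (congr1 P); apply: eq_event => w; rewrite det_wperm_tperm.
    + apply: (congr1 P); apply: eq_event => w; apply: (congr1 (fun M => _ * \det (_ - M)));
      by apply: eq_wperm => k; rewrite /z lift_widen.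
  - apply: (congr1 P); apply: eq_event => w; rewrite det_wperm_fix mulrA;
    apply: (congr1 (fun M => _ * \det (_ - M))); by apply: eq_wperm => k; rewrite /= /z lift_widen.
rewrite big_split /= -ge0_sume_distrr; last by move=> s _; exact: measure_ge0.
rewrite (IH _ _ mY' mA) (IH _ _ mZ mA).
pose Q w := \prod_(k < n) (1 - z' k w * of_real (X (widen_ord (ltnW le) k) w)).
pose i0 : 'I_N + 'I_N := inr (widen_ord le ord_max).
have mQ : cmeasurable (Q : past W (~: [set i0]) -> Cplx R).
  apply: cmeasurable_prod => k; apply: cmeasurableD; first exact: cmeasurable_cst.
  apply: cmeasurableN; apply: cmeasurableM.
    by apply: cmeasurable_past_expi; rewrite !inE.
  apply: cmeasurable_past_of_real; rewrite !inE; apply/eqP => -[] /eqP.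
  by rewrite ltn_eqF.
have laterJ : later n.+1 \subset ~: [set i0] by apply: later_lt => /=.
have mYJ := cmeasurable_past_le laterJ mY.
have mZJ : cmeasurable (Z : past W (~: [set i0]) -> Cplx R).
  apply: cmeasurableM => //; apply: cmeasurableD; first exact: cmeasurable_cst.
  by apply: cmeasurableN; apply: cmeasurable_past_expi; rewrite !inE.
have toT (f : T -> Cplx R) J : cmeasurable (f : past W J -> Cplx R) -> cmeasurable f.
  by apply: cmeasurable_comp; exact: measurable_to_past.
pose h w := Y w * \prod_(k < n.+1) (1 - z k w * of_real (X (widen_ord le k) w)).
have hE w : h w = Y w * Q w * (1 - z ord_max w * of_real (X (widen_ord le ord_max) w)).
  rewrite /h big_ord_recr /= mulrA; congr (_ * _ * _).
  by apply: eq_bigr => k _; rewrite /z widen_widen.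
have mh : cmeasurable h.
  apply: cmeasurableM; first exact: toT mY.
  apply: cmeasurable_prod => k; apply: cmeasurableD; first exact: cmeasurable_cst.
  apply: cmeasurableN; apply: cmeasurableM; first exact: cmeasurable_expi.
  exact: cmeasurable_of_real.
(* The value 1 of the last Bernoulli variable keeps the factor and yields [Z]; the value 0 erases it
   and leaves [Y]. *)
have -> := @bernoulli_mixture (widen_ord le ord_max) h (fun w => Y w * Q w)
  (fun w => Z w * Q w) A mh (cmeasurableM mYJ mQ) (cmeasurableM mZJ mQ) _ _ mA.
- have mset (f : T -> Cplx R) : cmeasurable f -> P (f @^-1` A) \is a fin_num.
    by move=> mf; apply: fin_num_measure; exact: cmeasurable_preimage.
  rewrite -[P [set w | A (Y w * _)]]/(P ((fun w => Y w * Q w) @^-1` A)).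
  rewrite -[P [set w | A (Z w * _)]]/(P ((fun w => Z w * Q w) @^-1` A)).
  rewrite -(fineK (mset _ (toT _ _ (cmeasurableM mYJ mQ)))).
  rewrite -(fineK (mset _ (toT _ _ (cmeasurableM mZJ mQ)))).
  (* The weights match: [(n+1)!] times [1/(n+1)] is [n!], and [(n+1)!] times [1 - 1/(n+1)] is [n]
     times [n!]. *)
  rewrite -!EFinM -!EFinD; congr EFin; rewrite factS natrM /=.
  by field; rewrite ?nat1r ?natr1 pnatr_eq0.
- move=> w Xw; rewrite hE Xw.
  by rewrite -[of_real 0]/(0 : Cplx R) mulr0 subr0 mulr1.
- move=> w Xw; rewrite hE Xw.
  by rewrite -[of_real 1]/(1 : Cplx R) mulr1 /Z mulrAC.
Qed.

(** Constant rotations are removed one index at a time, each by [skew_shift] with a constant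
    angle. *)
Lemma remove_phases (s : 'S_N) (c : 'I_N -> R) (A : set (borelType (Cplx R))) :
  measurable A ->
  P [set w | A (\det (1%:M - wperm s (fun k => expi (theta k w + c k))))] =
  P [set w | A (\det (1%:M - wperm s (fun k => expi (theta k w))))].
Proof.
move=> mA.
(* Only the first [m] rotations are kept; the induction on [m] runs from none of them to all. *)
pose u m (k : 'I_N) := if (k < m)%N then c k else 0.
suff H m : P [set w | A (\det (1%:M - wperm s (fun k => expi (theta k w + u m k))))] =
    P [set w | A (\det (1%:M - wperm s (fun k => expi (theta k w))))].
  etransitivity; [|exact: (H N)].
  apply: (congr1 P); apply: eq_event => w; apply: (congr1 (fun M => \det (_ - M)));
  by apply: eq_wperm => k; rewrite /u ltn_ord.
elim: m => [|m IH].
  apply: (congr1 P); apply: eq_event => w; apply: (congr1 (fun M => \det (_ - M)));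
  by apply: eq_wperm => k; rewrite /u addr0.
etransitivity; [|exact: IH].
have [mN|Nm] := ltnP m N; last first.
  apply: (congr1 P); apply: eq_event => w; apply: (congr1 (fun M => \det (_ - M)));
  apply: eq_wperm => k;
  by rewrite /u (leq_trans (ltn_ord k) Nm) (leq_trans (ltn_ord k) (leqW Nm)).
pose i := Ordinal mN; pose i0 : 'I_N + 'I_N := inl i; pose J := ~: [set i0].
pose H w (t : R) := \det (1%:M - wperm s (fun k =>
  if k == i then expi t else expi (theta k w + u m k))).
have i0J : i0 \notin J by rewrite !inE eqxx.
have mH : cmeasurable (fun p : past W J * R => H p.1 p.2).
  apply: cmeasurable_det => a b.
  under [X in cmeasurable X]eq_fun do rewrite !mxE.
  apply: cmeasurableD; first exact: cmeasurable_cst.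
  apply: cmeasurableN; apply: cmeasurableM; last exact: cmeasurable_cst.
  case: eqVneq => [_|bi]; first by apply: cmeasurable_expi; exact: measurable_snd.
  apply: (cmeasurable_comp (f := fst : past W J * R -> past W J)
    (h := fun w : past W J => expi (theta b w + u m b))); first exact: measurable_fst.
  apply: cmeasurable_expi; apply: measurable_funD; last exact: measurable_cst.
  by apply: (measurable_past_rv (W := W) (i := inl b)); rewrite !inE.
have perH w t : H w (t + 2 * pi) = H w t by rewrite /H expiD2pi.
have malpha : measurable_fun setT ((fun=> c i) : past W J -> R) by [].
have := skew_shift indepW i0J (htheta _) perH mH malpha mA.
rewrite /H /W /= => HE; etransitivity; [|etransitivity; [exact: HE|]].
- apply: (congr1 P); apply: eq_event => w; apply: (congr1 (fun M => \det (_ - M)));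
  apply: eq_wperm => k; rewrite /u ltnS leq_eqVlt; case: (eqVneq k i) => [->|ki].
    by rewrite /= eqxx.
  by move: ki; rewrite -val_eqE /= => /negPf ->.
- apply: (congr1 P); apply: eq_event => w; apply: (congr1 (fun M => \det (_ - M)));
  apply: eq_wperm => k; rewrite /u; case: (eqVneq k i) => [->|_]; last by [].
  by rewrite ltnn addr0.
Qed.

End ClaimInduction.

(** * The group of permutation matrices with phases *)

Lemma expi_surj (R : realType) (z : Cplx R) :
  complex.Re z ^+ 2 + complex.Im z ^+ 2 = 1 -> exists t : R, z = expi t.
Proof.
case: z => a b /= ab1.
have a2 : a ^+ 2 <= 1 by rewrite -ab1 lerDl sqr_ge0.
have a1 : -1 <= a <= 1 by rewrite -ler_norml -(expr_le1 (n := 2)) // real_normK ?num_real.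
have bE : 1 - a ^+ 2 = b ^+ 2 by rewrite -ab1 addrC addKr.
have aK : cos (acos a) = a by rewrite acosK // in_itv.
have [b0|b0] := leP 0 b.
  by exists (acos a); rewrite /expi aK sin_acos // bE sqrtr_sqr ger0_norm.
exists (- acos a); rewrite /expi cosN sinN aK sin_acos // bE sqrtr_sqr.
by rewrite ltr0_norm // opprK.
Qed.

Section PhasePermGroup.
Context (R : realType) (N : nat).
Implicit Types (s t : 'S_N) (a b : 'I_N -> R).

Lemma expi0 : expi (0 : R) = 1.
Proof. by rewrite /expi cos0 sin0. Qed.

Lemma phase_perm_mxM s t a b :
  phase_perm_mx s a *m phase_perm_mx t b =
  phase_perm_mx (s * t)%g (fun j => a ((t^-1)%g j) + b j).
Proof.
apply/matrixP => i j; rewrite !mxE (bigD1 (s i)) //= big1 => [|k /negPf ki].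
  rewrite !mxE eqxx mulr1 addr0 permM mulrA -expiD.
  by case: eqVneq => [->|_]; [rewrite permK|rewrite !mulr0].
by rewrite !mxE ki mulr0 mul0r.
Qed.

Lemma phase_perm_mx1 : phase_perm_mx 1 (fun=> 0) = 1%:M :> 'M[Cplx R]_N.
Proof. by apply/matrixP => i j; rewrite !mxE perm1 expi0 mul1r eq_sym. Qed.

Lemma det_phase_perm_mx_neq0 s a : \det (phase_perm_mx s a) != 0.
Proof.
have : phase_perm_mx s a *m phase_perm_mx s^-1 (fun j => - a (s j)) = 1%:M.
  rewrite phase_perm_mxM -phase_perm_mx1 mulgV; apply/matrixP => i j.
  by rewrite !mxE invgK subrr.
move=> /(congr1 determinant); rewrite det_mulmx det1 => /eqP.
by apply: contraTneq => ->; rewrite mul0r eq_sym oner_eq0.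
Qed.

(** Both sides agree after multiplication by [\det m], since [m (1 - g m) = (1 - m g) m]. *)
Lemma det_1subM_comm n (K : idomainType) (g m : 'M[K]_n) : \det m != 0 ->
  \det (1%:M - g *m m) = \det (1%:M - m *m g).
Proof.
move=> m0; apply: (mulfI m0); rewrite -det_mulmx [RHS]mulrC -det_mulmx.
by rewrite mulmxBr mulmxBl mulmx1 mul1mx mulmxA.
Qed.

(** The group is a finite union, over permutations, of sets prescribing each squared modulus as 0 or
    1; an entry of modulus 1 supplies its phase through [expi_surj]. *)
Lemma phase_perm_group_measurable :
  measurable (phase_perm_group R N : set (borelType 'M[Cplx R]_N)).
Proof.
pose q (i j : 'I_N) (M : borelType 'M[Cplx R]_N) : R :=
  complex.Re ((M : 'M[Cplx R]_N) i j) ^+ 2 + complex.Im ((M : 'M[Cplx R]_N) i j) ^+ 2.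
have mq i j r : measurable (q i j @^-1` [set r]).
  have [mr mi] := cmeasurable_entry R i j.
  rewrite -[X in measurable X]setTI; apply: measurable_funD => //.
    exact: measurable_funX.
  exact: measurable_funX.
have -> : phase_perm_group R N = \bigcup_(s in [set: 'S_N])
    \bigcap_(p in [set: 'I_N * 'I_N]) (q p.1 p.2 @^-1` [set (p.2 == s p.1)%:R]).
  apply/seteqP; split => [M [s [a ->]]|M [s _ Ms]].
    exists s => // -[i j] _ /=; rewrite /q !mxE; case: eqP => _.
      by rewrite mulr1 /= cos2Dsin2.
    by rewrite mulr0 /= expr0n /= addr0.
  have ex j : exists t : R, M ((s^-1)%g j) j = expi t.
    apply: expi_surj; have := Ms ((s^-1)%g j, j) I.
    by rewrite /q /= permKV eqxx.
  pose a j := projT1 (cid (ex j)).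
  exists s, a; apply/matrixP => i j; rewrite !mxE.
  case: eqVneq => [->|jsi].
    rewrite mulr1 /a; case: cid => t /=; by rewrite permK.
  have := Ms (i, j) I; rewrite /q /= (negPf jsi) mulr0 => /eqP.
  rewrite paddr_eq0 ?sqr_ge0 // !sqrf_eq0.
  by case: (M i j) => u v /= /andP[/eqP -> /eqP ->].
apply: fin_bigcup_measurable => [|s _]; first exact: finite_finset.
by apply: fin_bigcap_measurable => [|p _]; [exact: finite_finset|exact: mq].
Qed.

End PhasePermGroup.

(** * Averaging the Haar law over random translates *)

Section HaarAverage.
Context (R : realType) (N : nat) d (T : measurableType d) (P : probability T R).
Context (theta X : 'I_N -> {RV P >-> R}).
Hypothesis htheta : forall k, uniform_phase (theta k).
Hypothesis hX : forall k : 'I_N, bernoulli_rv (X k) (k.+1%:R^-1).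
Hypothesis indepW : mutually_independent
  (fun i : 'I_N + 'I_N => match i with inl k => theta k | inr k => X k end).

Let G (t : 'S_N) w := phase_perm_mx t (fun k => theta k w).

Lemma phase_perm_wperm (s : 'S_N) (a : 'I_N -> R) :
  phase_perm_mx s a = wperm s (fun k => expi (a k)).
Proof. by []. Qed.

(** Exchanging the factors to [M G] keeps each random phase at its own column: [M] only multiplies
    the permutation on the left by [s] and adds constant angles. The sum is therefore the same for
    every [M] in the group. *)
Lemma sum_translates_law (M : 'M[Cplx R]_N) (A : set (borelType (Cplx R))) :
  phase_perm_group R N M -> measurable A ->
  (\sum_(t : 'S_N) P [set w | A (\det (1%:M - G t w *m M))] =
   N`!%:R%:E * P [set w | A (\prod_(k < N) (1 - expi (theta k w) * of_real (X k w)))%R])%E.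
Proof.
move=> [s [phi ->]] mA.
transitivity (\sum_(t : 'S_N) P [set w | A (\det (1%:M -
    wperm t (fun k => expi (theta k w))))])%E.
  rewrite [RHS](reindex_inj (mulgI s)); apply: eq_bigr => t _.
  have := @remove_phases R N d T P theta X htheta indepW (s * t)%g
    (fun j => phi ((t^-1)%g j)) A mA.
  move=> HE; etransitivity; [|exact: HE].
  apply: (congr1 P); apply: eq_event => w.
  rewrite det_1subM_comm; last exact: det_phase_perm_mx_neq0.
  rewrite /G phase_perm_mxM phase_perm_wperm.
  by apply: (congr1 (fun M => \det (_ - M))); apply: eq_wperm => k; rewrite addrC.
have widen k : widen_ord (leqnn N) k = k by exact/val_inj.
(* The induction is started at full size with trivial prefactor 1. *)
have := @wperm_sum_law R N d T P theta X htheta hX indepW N (leqnn N) (fun=> 1) A.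
move=> /(_ (cmeasurable_cst _ _) mA) /= HE.
etransitivity; [|etransitivity; [exact: HE|]].
  apply: eq_bigr => s' _; apply: (congr1 P); apply: eq_event => w.
  rewrite mul1r; apply: (congr1 (fun M => \det (_ - M))).
  by apply: eq_wperm => k; rewrite widen.
apply: (congr1 (fun x => _ * x)%E).
apply: (congr1 P); apply: eq_event => w; rewrite mul1r.
by apply: eq_bigr => k _; rewrite widen.
Qed.

(** The event that [f t] lies in [A] is measured under [Q] times [P] and summed over [t].
    Integrating over [u] first gives [q] for each [t], by Haar invariance; integrating over [w]
    first gives [N!] times [p], by the law of translates. *)
Lemma haar_average d' (U : measurableType d') (Q : probability U R)
    (S : {RV Q >-> borelType 'M[Cplx R]_N}) (A : set (borelType (Cplx R))) :
  is_haar_probability (phase_perm_group R N) (distribution Q S) -> measurable A ->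
  Q [set u | A (\det (1%:M - (S u : 'M[Cplx R]_N)))] =
  P [set w | A (\prod_(k < N) (1 - expi (theta k w) * of_real (X k w)))].
Proof.
move=> [SG Sinv] mA.
set q := Q _; set p := P _.
pose f (t : 'S_N) (x : U * T) : Cplx R := \det (1%:M - G t x.2 *m (S x.1 : 'M[Cplx R]_N)).
have mf t : cmeasurable (f t).
  apply: cmeasurable_det => i j.
  under [X in cmeasurable X]eq_fun do rewrite !mxE.
  apply: cmeasurableD; first exact: cmeasurable_cst.
  apply: cmeasurableN; apply: cmeasurable_sum => k; apply: cmeasurableM.
    under [X in cmeasurable X]eq_fun do rewrite !mxE.
    apply: cmeasurableM; last exact: cmeasurable_cst.
    apply: cmeasurable_expi; apply: measurableT_comp; last exact: measurable_snd.
    exact: measurable_funP.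
  apply: (cmeasurable_comp (f := fun x : U * T => S x.1) _ (cmeasurable_entry R k j)).
  by apply: measurableT_comp; [exact: measurable_funP|exact: measurable_fst].
pose E t : set (U * T) := f t @^-1` A.
have mE t : measurable (E t) by exact: cmeasurable_preimage.
have fubini t : (\int[Q]_u P (xsection (E t) u) = q)%E.
  transitivity ((Q \x P)%E (E t)); first by [].
  (* Tonelli: the two iterated product measures coincide, so [w] can be fixed and [S] translated by
     the group element [G t w]. *)
  transitivity ((Q \x^ P)%E (E t)).
    apply: product_measure_unique => //.
    by move=> B C mB mC; exact: product_measure2E.
  transitivity (\int[P]_w (cst q w))%E; last first.
    rewrite integral_cst // -[RHS]mule1.
    by apply: (congr1 (fun x => q * x)%E); exact: probability_setT.
  apply: eq_integral => w _ /=.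
  pose D : set (borelType 'M[Cplx R]_N) :=
    (fun M : borelType 'M[Cplx R]_N => \det (1%:M - (M : 'M[Cplx R]_N))) @^-1` A.
  have mD : measurable D.
    apply: cmeasurable_preimage mA; apply: cmeasurable_det => i j.
    under [X in cmeasurable X]eq_fun do rewrite !mxE.
    apply: cmeasurableD; first exact: cmeasurable_cst.
    by apply: cmeasurableN; exact: cmeasurable_entry.
  have GG : phase_perm_group R N (G t w) by exists t, (fun k => theta k w).
  have := Sinv _ _ GG mD; rewrite /distribution /pushforward => HE.
  etransitivity; [|exact: HE].
  apply: (congr1 Q); apply/seteqP; split => u; rewrite /ysection /= inE;
  exact: id.
have Nq : (N`!%:R%:E * q = N`!%:R%:E * p)%E.
  transitivity (\sum_(t : 'S_N) \int[Q]_u P (xsection (E t) u))%E.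
    under eq_bigr do rewrite fubini.
    by rewrite big_const card_Sn iter_addr_0 mule_natl.
  rewrite -ge0_integral_sum //; last first.
    by move=> t; exact: measurable_fun_xsection.
  transitivity (\int[Q]_u (cst (N`!%:R%:E * p)%E u))%E; last first.
    rewrite integral_cst // -[RHS]mule1.
    by apply: (congr1 (fun x => _ * x)%E); exact: probability_setT.
  (* The integrand is known to be constant only where [S u] lies in the group, an event of
     probability 1. *)
  apply: ae_eq_integral => //.
    by apply: emeasurable_sum => t; exact: measurable_fun_xsection.
  have mSG : measurable (S @^-1` phase_perm_group R N).
    rewrite -[X in measurable X]setTI.
    by apply: measurable_funP => //; exact: phase_perm_group_measurable.
  exists (~` (S @^-1` phase_perm_group R N)); split.
  - exact: measurableC.
  - apply: (etrans (probability_setC Q mSG)).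
    by apply: (etrans (congr1 (fun x => 1 - x)%E SG)); rewrite subee.
  - move=> u /= nu SuG; apply: nu => _ /=; rewrite -(sum_translates_law SuG mA).
    apply: eq_bigr => t _; apply: (congr1 P).
    by apply/seteqP; split => w; rewrite /xsection /= inE; exact: id.
have N0 : (N`!%:R : R) != 0 by rewrite pnatr_eq0 -lt0n fact_gt0.
have := congr1 (fun x => (N`!%:R^-1)%:E * x)%E Nq.
by rewrite !muleA -EFinM mulVf // !mul1e.
Qed.

End HaarAverage.

(** * Equality in law of the determinant and the product *)

Theorem corollary1p4 (R : realType) (N : nat) (hN : (0 < N)%N)
  (d : measure_display) (Omega : measurableType d) (P : probability Omega R)
  (S : {RV P >-> borelType 'M[Cplx R]_N})
  (hS : is_haar_probability (phase_perm_group R N) (distribution P S))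
  (d' : measure_display) (Omega' : measurableType d')
  (P' : probability Omega' R)
  (theta X : 'I_N -> {RV P' >-> R})
  (htheta : forall k : 'I_N, uniform_phase (theta k))
  (hX : forall k : 'I_N, bernoulli_rv (X k) (k.+1%:R^-1))
  (hindep : mutually_independent
     (fun i : 'I_N + 'I_N => match i with inl k => theta k | inr k => X k end)) :
  eq_in_law (T' := borelType (Cplx R)) P P'
    (fun w => \det (1%:M - (S w : 'M[Cplx R]_N)))
    (fun w => \prod_(k < N) (1 - expi (theta k w) * of_real (X k w))).
Proof.
have mdet : cmeasurable (fun w => \det (1%:M - (S w : 'M[Cplx R]_N))).
  apply: cmeasurable_det => i j.
  under [X in cmeasurable X]eq_fun do rewrite !mxE.
  apply: cmeasurableD; first exact: cmeasurable_cst.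
  apply: cmeasurableN.
  exact: (cmeasurable_comp (measurable_funP S) (cmeasurable_entry R i j)).
have mprod : cmeasurable (fun w =>
    \prod_(k < N) (1 - expi (theta k w) * of_real (X k w))).
  apply: cmeasurable_prod => k; apply: cmeasurableD; first exact: cmeasurable_cst.
  apply: cmeasurableN; apply: cmeasurableM.
    by apply: cmeasurable_expi; exact: measurable_funP.
  by apply: cmeasurable_of_real; exact: measurable_funP.
split; [exact: cmeasurable_borel|exact: cmeasurable_borel|].
by move=> A mA; exact: haar_average.
Qed.
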